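(* Let $(T,\le)$ be an order tree. (i) There exists a uniform $T$-graph if and only if $(T,\le)$ embeds into $(\mathbb Q,\le)$. (ii) There exists a $T$-graph of finite adhesion if and only if $(T,\le)$ embeds into $(\mathbb R,\le)$.
   Context: An order tree is a poset $(T,\le)$ with a unique minimal element in which every $\lceil t\rceil=\{t'\le t\}$ is well-ordered; $\mathring{\lceil t\rceil}=\lceil t\rceil\setminus\{t\}$. $t'$ is a successor of $t$ if $t<t'$ with no point strictly between; a point is a limit if it is not a successor of any point. The height of $t$ is the order type of $\mathring{\lceil t\rceil}$; $T^{\le\sigma}$ is the set of points of height at most $\sigma$. A graph $G$ is a $T$-graph if $V(G)=T$, endvertices of every edge are comparable in $T$, and for each $t$ the set of neighbours of $t$ below $t$ is cofinal in $\mathring{\lceil t\rceil}$. A $T$-graph has finite adhesion if for every limit ordinal $\sigma$ every component of $G-T^{\le\sigma}$ has finite neighbourhood. A $T$-graph is uniform if for every limit $t$ there is a finite $S_t\subset\mathring{\lceil t\rceil}$ such that every $t'>t$ has all its neighbours $s$ with $s<t$ in $S_t$. A poset $P$ embeds into a poset $Q$ if there is a map $f\colon P\to Q$ with $p<p'\Rightarrow f(p)<f(p')$ (not required to be injective). *)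

(* Defs.v *)
(* MathComp, with the classical and reals layers of MathComp-Analysis *)
From HB Require Import structures.
From mathcomp Require Export all_boot all_order all_algebra.
From mathcomp Require Export boolp classical_sets cardinality wochoice reals.

Set Implicit Arguments.
Unset Strict Implicit.
Unset Printing Implicit Defensive.

Import Order.TTheory.
Local Open Scope classical_set_scope.
Local Open Scope order_scope.

(* The embeddings need not be injective. *)
Definition embeds (d d' : Order.disp_t) (P : porderType d) (Q : porderType d')
  : Prop :=
  exists f : P -> Q, {homo f : p p' / p < p'}.

Section OrderTypes.

Definition well_ordered (d : Order.disp_t) (P : porderType d) (A : set P)
  : Prop :=
  wo_chain (<=%O : rel P) [in A].

(* For well-ordered A and nonempty well-ordered B: the order type of A is at
   most that of B, i.e., A is order-isomorphic to an initial segment of B. *)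
Definition order_type_le (d d' : Order.disp_t)
    (P : porderType d) (Q : porderType d') (A : set P) (B : set Q) : Prop :=
  exists f : P -> Q,
    [/\ f @` A `<=` B,
        (forall x y, A x -> A y -> x < y -> f x < f y) &
        (forall x b, A x -> B b -> b < f x -> (f @` A) b)].

(* Ordinals are represented by well-ordered subsets of partially ordered
   types, B standing for its order type. *)
Definition limit_ordinal (d : Order.disp_t) (P : porderType d) (B : set P)
  : Prop :=
  [/\ well_ordered B, B !=set0 & forall b, B b -> exists2 c, B c & b < c].

End OrderTypes.

Section OrderTrees.
Context {d : Order.disp_t} {T : porderType d}.

Definition down_closure (t : T) : set T := [set s | s <= t].

Definition strict_down_closure (t : T) : set T := down_closure t `\ t.

Definition minimal (r : T) : Prop := ~ exists s, s < r.

Definition successor_of (s t : T) : Prop :=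
  s < t /\ ~ exists u, s < u < t.

(* The root is a limit. *)
Definition limit (t : T) : Prop := ~ exists s, successor_of s t.

(* T^{<= sigma}, where sigma is the order type of B. *)
Definition levels_upto (d' : Order.disp_t) (Q : porderType d') (B : set Q)
  : set T :=
  [set t | order_type_le (strict_down_closure t) B].

Definition cofinal (A B : set T) : Prop :=
  A `<=` B /\ forall b, B b -> exists2 a, A a & b <= a.

End OrderTrees.

Definition order_tree (d : Order.disp_t) (T : porderType d) : Prop :=
  (exists! r : T, minimal r) /\ forall t : T, well_ordered (down_closure t).

Record graph (V : Type) := Graph {
  adj :> rel V;
  adj_sym : symmetric adj;
  adj_irrefl : irreflexive adj }.

Section Graphs.
Context {V : Type} (G : graph V).

(* x and y are joined by a path of the induced subgraph G[A]. *)
Definition connected_in (A : set V) (x y : V) : Prop :=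
  exists p : seq V,
    [/\ path G x p, last x p = y & forall i, (i <= size p)%N -> A (nth x (x :: p) i)].

Definition component_of (A : set V) (C : set V) : Prop :=
  exists2 x, A x & C = [set y | connected_in A x y].

Definition neighbourhood (C : set V) : set V :=
  [set v | ~ C v /\ exists2 u, C u & G u v].

End Graphs.

Section TGraphs.
Context {d : Order.disp_t} {T : porderType d} (G : graph T).

Definition lower_neighbours (t : T) : set T := [set s | G t s /\ s < t].

Definition T_graph : Prop :=
  (forall s t : T, G s t -> s >=< t) /\
  (forall t : T, cofinal (lower_neighbours t) (strict_down_closure t)).

Definition finite_adhesion : Prop :=
  forall (d' : Order.disp_t) (Q : porderType d') (B : set Q),
    limit_ordinal B ->
    forall C : set T, component_of G (~` levels_upto B) C ->
      finite_set (neighbourhood G C).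

Definition uniform : Prop :=
  forall t : T, limit t ->
    exists S : set T,
      [/\ finite_set S, S `<=` strict_down_closure t &
          forall t' s : T, t < t' -> G t' s -> s < t -> S s].

End TGraphs.

(* Main.v *)
(* Embeddings and graphs are both equivalent to a coloring c by natural numbers
   that is injective on chains: on all of T for (i), on the successors for (ii).
   From c one gets the maps sending t to the sum of 2^-n over the colors n
   occurring weakly below t; truncating the sum at n = c t makes it rational and
   keeps it strictly increasing.  Conversely a map to Q is such a coloring, and
   given a map to R a successor can be colored by a rational number between the
   values at its predecessor and at itself.
   From c one gets a graph by joining each limit t to the colored points s < t
   whose color is smaller than all colors strictly between s and t; an edge that
   jumps over a colored point t then ends in one of the finitely many points
   below t of color smaller than c t.
   From a graph one gets c by a regressive function with antichain fibers.  For
   (i), send a limit t to a neighbor of t below t that is not the lower end of an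
   edge jumping over t.  For (ii), send a successor t of a limit u to the point
   following, towards u, a neighbor of u below u that is not the lower end of an
   edge with upper end at or above t. *)
Require Import Defs.

Set Implicit Arguments.
Unset Strict Implicit.
Unset Printing Implicit Defensive.

Import Order.TTheory GRing.Theory Num.Theory.
Local Open Scope classical_set_scope.
Local Open Scope order_scope.

(** * Paths in induced subgraphs *)

Section Connectivity.
Context {V : Type} (G : graph V) (A : set V).

Lemma connected_in_step x y z :
  connected_in G A x y -> A z -> G y z -> connected_in G A x z.
Proof.
move=> [p [Gp py pA]] Az Gyz; exists (rcons p z); split.
- by rewrite rcons_path Gp py.
- by rewrite last_rcons.
move=> i; rewrite size_rcons -rcons_cons nth_rcons /= ltnS => ip.
case: leqP => [/pA //|pi].
by have -> : i == (size p).+1 by rewrite eqn_leq ip.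
Qed.

Lemma connected_in_invariant (P : V -> Prop) x y : (A x -> P x) ->
    (forall u v, P u -> A v -> G u v -> P v) ->
  connected_in G A x y -> P y.
Proof.
move=> Px Pstep [p [Gp <- pA]].
suff gen q u : P u -> path G u q -> (forall i, (i < size q)%N -> A (nth x q i)) ->
    P (last u q).
  by apply: gen Gp _ => [|i]; [apply: Px; apply: (pA 0%N)|apply: (pA i.+1)].
elim: q u => //= v q IH u Pu /andP[Guv Gq] qA; apply: IH Gq _.
  by apply: Pstep Guv => //; apply: (qA 0%N).
by move=> i iq; apply: (qA i.+1).
Qed.

Lemma connected_in_mem x y : connected_in G A x y -> A y.
Proof. exact: connected_in_invariant. Qed.

End Connectivity.

(** * Successors and limits in order trees *)

Section OrderTreeTheory.
Context {d : Order.disp_t} {T : porderType d}.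
Hypothesis hT : order_tree T.
Implicit Types (s t u v w : T) (A S X : set T).

Lemma least_below A t : A t ->
  exists m, [/\ A m, m <= t & forall s, A s -> s <= t -> m <= s].
Proof.
move=> At; have [||m [[/asboolP[Am mt] mmin] _]] :=
    hT.2 t (fun x => `[< A x /\ x <= t >]).
- by move=> x /asboolP[_ xt]; rewrite inE.
- by exists t; apply/asboolP.
by exists m; split=> // s As st; apply: mmin; apply/asboolP.
Qed.

Lemma strict_down_closureP s t : strict_down_closure t s <-> s < t.
Proof.
split=> [[/= st /eqP nst]|st]; first by rewrite lt_neqAle nst.
by split=> [|/= stE]; [exact: ltW|move: st; rewrite stE ltxx].
Qed.

Lemma comparable_below s t u : s <= u -> t <= u -> s >=< t.
Proof.
by move=> su tu; apply: (wo_chainW (hT.2 u)); rewrite inE.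
Qed.

Lemma tree_ind (P : T -> Prop) :
  (forall t, (forall s, s < t -> P s) -> P t) -> forall t, P t.
Proof.
move=> Pind t; apply: contrapT => nPt.
have [m [nPm mt mmin]] := least_below (nPt : [set s | ~ P s] t).
apply: nPm; apply: Pind => s sm; apply: contrapT => nPs.
by have := mmin _ nPs (le_trans (ltW sm) mt); rewrite (lt_geF sm).
Qed.

Lemma exists_successor s t : s < t -> exists2 u, successor_of s u & u <= t.
Proof.
move=> st; have [u [su ut umin]] := least_below (st : [set u | s < u] t).
exists u => //; split=> // -[v /andP[sv vu]].
by have := umin v sv (le_trans (ltW vu) ut); rewrite (lt_geF vu).
Qed.

Lemma limit_successor s t :
  limit t -> s < t -> exists2 u, successor_of s u & u < t.
Proof.
move=> lt_t /exists_successor[u su]; rewrite le_eqVlt.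
move=> /predU1P[ut|]; last by exists u.
by case: lt_t; exists s; rewrite -ut.
Qed.

Lemma successor_of_le s t u : successor_of s t -> u < t -> u <= s.
Proof.
move=> [st nst] ut; have /comparable_leP := comparable_below (ltW ut) (ltW st).
by case=> // su; case: nst; exists u; rewrite su.
Qed.

Lemma successor_of_inj s s' t : successor_of s t -> successor_of s' t -> s = s'.
Proof.
move=> st s't; apply/le_anti.
by rewrite !(@successor_of_le _ t) //; case: st s't => ? _ [].
Qed.

Lemma nonminimal t : ~ minimal t -> exists s, s < t.
Proof. exact: contrapT. Qed.

(** Induction on a list of [S]: a bound [b] with [b <= a < t] moves up to the successor of [a]
    towards [t], still below the limit [t]. *)
Lemma limit_avoid_finite t S : limit t -> ~ minimal t -> finite_set S ->
  exists2 b, b < t & forall s, S s -> s < t -> ~ b <= s.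
Proof.
move=> lt_t /nonminimal[b0 b0t] /finite_seqP[l ->].
elim: l => [|a l [b bt lb]]; first by exists b0.
have [/andP[ba /(limit_successor lt_t)[c [ac _] ct]]|nab] :=
    pselect (b <= a < t).
- exists c => // s; rewrite /= inE => /predU1P[->|sl] st cs.
    by have := lt_le_trans ac cs; rewrite ltxx.
  by apply: (lb s) => //; apply: le_trans cs; apply: le_trans (ltW ac).
- exists b => // s; rewrite /= inE => /predU1P[->|sl] st bs; last exact: (lb s).
  by apply: nab; rewrite bs.
Qed.

Lemma limit_neighbour_avoid (G : graph T) t S :
    T_graph G -> limit t -> ~ minimal t -> finite_set S ->
  exists s, [/\ G t s, s < t & ~ S s].
Proof.
move=> [_ Gcof] lt_t nmin /(limit_avoid_finite lt_t nmin)[b bt bS].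
have [|s [Gts st] bs] := (Gcof t).2 b.
  exact/strict_down_closureP.
by exists s; split=> // Ss; apply: (bS s).
Qed.

(** * Colorings from regressive relations *)

Fixpoint regressive_code X (P : bool -> T -> T -> Prop) (l : seq bool) t : Prop :=
  if l is b :: l' then
    exists s, [/\ X s, s < t, P b t s & regressive_code X P l' s]
  else minimal t.

(* Descending along [P] reaches a minimal point after finitely many steps, and
   the sequence of colours met on the way determines the starting point among
   all points of a chain. *)
Lemma regressive_coloring X (P : bool -> T -> T -> Prop) :
    (forall t, X t -> ~ minimal t -> exists b s, [/\ X s, s < t & P b t s]) ->
    (forall b s t t', X t -> X t' -> t < t' -> P b t s -> P b t' s -> False) ->
  exists c : T -> nat, forall s t, X s -> X t -> s < t -> c s <> c t.
Proof.
move=> Pex Puniq.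
have codeE t : X t -> exists l, regressive_code X P l t.
  elim/tree_ind: t => t IH Xt.
  have [mint|/(Pex _ Xt)[b [s [Xs st Pbts]]]] := pselect (minimal t).
    by exists [::].
  by have [l ls] := IH s st Xs; exists (b :: l), s.
have codeI l s t u : X s -> X t -> s <= u -> t <= u ->
    regressive_code X P l s -> regressive_code X P l t -> s = t.
  elim: l s t => [|b l IH] s t Xs Xt su tu /=.
    move=> mins mint; have /comparable_ltgtP[st|ts|//] := comparable_below su tu.
      by case: mint; exists s.
    by case: mins; exists t.
  move=> [s' [Xs' s's Ps cs]] [t' [Xt' t't Pt ct]].
  have s't' : s' = t'.
    by apply: IH cs ct => //; apply/ltW; [apply: lt_le_trans su|apply: lt_le_trans tu].
  have /comparable_ltgtP[st|ts|//] := comparable_below su tu.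
    by case: (@Puniq b s' s t) => //; rewrite s't'.
  by case: (@Puniq b s' t s) => //; rewrite s't'.
(* A point can have several codes; one is chosen, with the empty list as default outside [X]. *)
have /choice[f fP] t : exists l, X t -> regressive_code X P l t.
  by have [/codeE[l lt]|nXt] := pselect (X t); [exists l|exists [::]].
exists (pickle \o f) => s t Xs Xt st /(pcan_inj pickleK) fst.
have := codeI (f s) s t t Xs Xt (ltW st) (lexx t) (fP s Xs).
by rewrite fst => /(_ (fP t Xt)) sEt; move: st; rewrite sEt ltxx.
Qed.

(** * Binary sums of colors *)

Section WeightSums.
Local Open Scope ring_scope.
Context (X : set T) (c : T -> nat) (K : realFieldType).
Hypothesis c_inj : forall s t, X s -> X t -> (s < t)%O -> c s <> c t.

Definition color_below (n : nat) t : bool :=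
  `[< exists s, [/\ X s, (s <= t)%O & c s = n] >].

Definition weight_sum (N : nat) t : K :=
  \sum_(n < N) (color_below n t)%:R * 2^-1 ^+ n.

Lemma color_below_le n s t : (s <= t)%O -> color_below n s -> color_below n t.
Proof.
move=> st /asboolP[u [Xu us un]]; apply/asboolP; exists u; split=> //.
exact: le_trans st.
Qed.

Lemma weight_term_ge0 n t : 0 <= (color_below n t)%:R * 2^-1 ^+ n :> K.
Proof. by rewrite mulr_ge0 ?ler0n ?exprn_ge0 ?invr_ge0 ?ler0n. Qed.

Lemma weight_sum_widen M N t : (M <= N)%N -> weight_sum M t <= weight_sum N t.
Proof.
move=> /subnKC <-; elim: (N - M)%N => [|k IH]; first by rewrite addn0.
rewrite addnS; apply: (le_trans IH).
by rewrite /weight_sum big_ord_recr /= lerDl weight_term_ge0.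
Qed.

(** The right side adds the full geometric sum of [2^-n] over [M <= n < N], which dominates the new
    terms. *)
Lemma weight_sum_tail M N t : (M <= N)%N ->
  weight_sum N t <= weight_sum M t + 2 * 2^-1 ^+ M - 2 * 2^-1 ^+ N.
Proof.
move=> /subnKC <-; elim: (N - M)%N => [|k IH]; first by rewrite addn0 addrK.
rewrite addnS [weight_sum _.+1 _]big_ord_recr /= -/(weight_sum _ t).
have e0 : 0 <= 2^-1 ^+ (M + k) :> K by rewrite exprn_ge0 ?invr_ge0 ?ler0n.
have : (color_below (M + k) t)%:R * 2^-1 ^+ (M + k) <= 2^-1 ^+ (M + k) :> K.
  by case: (color_below _ _); rewrite ?mul1r ?mul0r.
have -> : 2 * 2^-1 ^+ (M + k).+1 = 2^-1 ^+ (M + k) :> K.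
  by rewrite exprS mulrA mulfV ?mul1r ?pnatr_eq0.
move: e0 IH; set e := 2^-1 ^+ (M + k); set a := weight_sum _ t => e0 IH be.
apply: (le_trans (lerD IH be)).
by rewrite [2 * e]mulr_natl mulr2n opprD -!addrA addNr addr0.
Qed.

(** The color of [u] does not occur weakly below [s], since [c] is injective on chains in [X]; so
    its term is gained, and no term is lost. *)
Lemma weight_sum_step N s t u : X u -> (s < u)%O -> (u <= t)%O -> (c u < N)%N ->
  weight_sum N s + 2^-1 ^+ c u <= weight_sum N t.
Proof.
move=> Xu su ut cuN; rewrite /weight_sum.
rewrite (bigD1 (Ordinal cuN)) //= [leRHS](bigD1 (Ordinal cuN)) //=.
have -> : color_below (c u) s = false.
  apply/asboolPn => -[v [Xv vs]]; apply: c_inj => //; apply: le_lt_trans vs su.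
have -> : color_below (c u) t by apply/asboolP; exists u.
rewrite mul0r add0r mul1r [leLHS]addrC lerD2l; apply: ler_sum => n _.
rewrite ler_wpM2r ?exprn_ge0 ?invr_ge0 ?ler0n // ler_nat.
have : (s <= t)%O by rewrite ltW // (lt_le_trans su).
by move=> /(color_below_le (n := n)); case: color_below => // ->.
Qed.

End WeightSums.

Lemma embeds_rat (c : T -> nat) :
  (forall s t, s < t -> c s <> c t) -> embeds T rat.
Proof.
move=> c_inj.
have cX s t : [set: T] s -> [set: T] t -> s < t -> c s <> c t.
  by move=> _ _; apply: c_inj.
exists (fun t => weight_sum setT c rat (c t).+1 t) => s t st.
have := weight_sum_step (N := (c t).+1) rat cX I st (lexx t) (leqnn _).
apply: lt_le_trans.
have e0 n : (0 < 2^-1 ^+ n :> rat)%R by rewrite exprn_gt0 ?invr_gt0.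
(* If [c s <= c t], the sum at [s] is cut no later than that at [t]. Otherwise its extra terms total
   less than [2 * 2^-(c t + 1)], which is the gain from color [c t]. *)
have [st'|ts'] := leqP (c s) (c t).
  apply: (@le_lt_trans _ _ (weight_sum setT c rat (c t).+1 s)).
    exact: weight_sum_widen.
  by rewrite ltrDl.
apply: le_lt_trans (weight_sum_tail _ _ _ _ (ltnW _ : ((c t).+1 <= (c s).+1)%N)) _ => //.
rewrite [X in (_ + _ * X - _)%R]exprS [X in (_ + X - _)%R]mulrA mulfV ?mul1r //.
by rewrite ltrBlDr ltrDl mulr_gt0.
Qed.

Lemma embeds_real (R : realType) X (c : T -> nat) :
    (forall s t, X s -> X t -> s < t -> c s <> c t) ->
    (forall s t, s < t -> exists x, [/\ X x, s < x & x <= t]) ->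
  embeds T R.
Proof.
move=> c_inj Xdense.
pose F t := range (fun N => weight_sum X c R N t).
have Fub t : has_ubound (F t).
  exists 2%R => _ [N _ <-]; have := weight_sum_tail X c R t (leq0n N).
  rewrite {2}/weight_sum big_ord0 add0r expr0 mulr1 => /le_trans; apply.
  by rewrite lerBlDr lerDl mulr_ge0 ?exprn_ge0 ?invr_ge0.
exists (fun t => sup (F t)) => s t /Xdense[x [Xx sx xt]].
(* The gain [2^-(c x)] is the same for all long partial sums, so strictness survives the
   supremum. *)
apply: (@lt_le_trans _ _ (sup (F s) + 2^-1 ^+ c x)%R).
  by rewrite ltrDl exprn_gt0 ?invr_gt0.
rewrite -lerBrDr; apply: ge_sup => [|_ [N _ <-]].
  by exists (weight_sum X c R 0 s); exists 0%N.
rewrite lerBrDr; apply: (@le_trans _ _ (weight_sum X c R (maxn N (c x).+1) t)).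
  apply: (le_trans _ (weight_sum_step R c_inj Xx sx xt (leq_maxr _ _))).
  by rewrite lerD2r weight_sum_widen ?leq_maxl.
by apply: ub_le_sup => //; exists (maxn N (c x).+1).
Qed.

(** * The graph of color records *)

Section RecordGraph.
Context (X : set T) (i : T -> nat).
Hypothesis i_inj : forall s t, X s -> X t -> s < t -> i s <> i t.

(** For a limit [t], the point [s] is the unique one of least color among the points of [X] in
    [[s, t)]. *)
Definition record_below s t : Prop :=
  s < t /\ (successor_of s t \/
    [/\ limit t, X s & forall u, X u -> s < u < t -> (i s < i u)%N]).

Definition record_adj s t : bool := `[< record_below s t \/ record_below t s >].

Lemma record_adj_sym : symmetric record_adj.
Proof. by move=> s t; apply/asboolP/asboolP => -[]; auto. Qed.

Lemma record_adj_irrefl : irreflexive record_adj.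
Proof.
by move=> t; apply/negbTE/asboolPn => -[] [+ _]; rewrite ltxx.
Qed.

Definition record_graph : graph T := Graph record_adj_sym record_adj_irrefl.

Lemma record_graph_below s t : record_graph t s -> s < t -> record_below s t.
Proof.
by move=> /asboolP[[ts _] st|//]; have := lt_trans st ts; rewrite ltxx.
Qed.

(** For a limit [t], the interval [[b, t)] meets [X] in the successor of [b] towards [t]; its point
    of least color is a neighbor of [t]. *)
Lemma record_graph_T : (forall s t, successor_of s t -> X t) ->
  T_graph record_graph.
Proof.
move=> Xsucc; split=> [s t /asboolP|t].
  move=> [[/ltW st _]|[/ltW ts _]]; first by rewrite /Order.comparable st.
  by rewrite /Order.comparable ts orbT.
split=> [s [_ st]|b /strict_down_closureP bt]; first exact/strict_down_closureP.
have [[p pt]|lt_t] := pselect (exists p, successor_of p t).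
  exists p; last exact: successor_of_le bt.
  by have [pt' _] := pt; split=> //; apply/asboolP; right; split=> //; left.
have [b' bb' b't] := limit_successor lt_t bt.
pose A := [set n | exists s, [/\ X s, b <= s, s < t & i s = n]].
have /ex_minnP[n /asboolP[s [Xs bs st <-]] smin] : exists n, `[< A n >].
  exists (i b'); apply/asboolP; exists b'; split=> //; first exact: Xsucc bb'.
  by case: bb' => /ltW.
exists s => //; split=> //; apply/asboolP; right; split=> //; right; split=> //.
move=> u Xu /andP[su ut]; rewrite ltn_neqAle; apply/andP; split.
  by apply/eqP; apply: i_inj.
by apply: smin; apply/asboolP; exists u; split=> //; apply: le_trans (ltW su).
Qed.

Lemma finite_color_below t n :
  finite_set [set s | [/\ X s, s < t & (i s < n)%N]].
Proof.
set A := [set s | _].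
have iA : {in A &, injective i}.
  move=> s s'; rewrite !inE => -[Xs st _] [Xs' s't _] /esym iss'.
  have /comparable_ltgtP[ss'|s's|//] := comparable_below (ltW st) (ltW s't).
    by case: (i_inj Xs Xs' ss').
  by case: (i_inj Xs' Xs s's).
rewrite -(eq_finite_set (inj_card_eq iA)).
by apply: sub_finite_set (finite_II n) => _ [s [_ _ sn] <-].
Qed.

(** An edge jumping over [t] does not join a point to its successor, so its lower end is a record
    and [t] is among the points it beats. *)
Lemma record_graph_across s t t' : X t -> s < t -> t < t' ->
  record_graph t' s -> X s /\ (i s < i t)%N.
Proof.
move=> Xt st tt' /record_graph_below[]; first exact: lt_trans tt'.
move=> _ [[_ []]|[_ Xs smin]]; first by exists t; rewrite st.
by split=> //; apply: smin => //; rewrite st.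
Qed.

End RecordGraph.

(** * Uniform graphs and colorings of all points *)

Lemma uniform_of_coloring (c : T -> nat) :
  (forall s t, s < t -> c s <> c t) -> exists G : graph T, T_graph G /\ uniform G.
Proof.
move=> c_inj; have cX s t : [set: T] s -> [set: T] t -> s < t -> c s <> c t.
  by move=> _ _; apply: c_inj.
exists (record_graph setT c); split; first exact: record_graph_T.
move=> t _; exists [set s | [/\ [set: T] s, s < t & (c s < c t)%N]]; split.
- exact: finite_color_below.
- by move=> s [_ st _]; apply/strict_down_closureP.
- move=> t' s tt' Gt's st.
  by have [] := record_graph_across (X := setT) I st tt' Gt's.
Qed.

Lemma coloring_of_uniform (G : graph T) : T_graph G -> uniform G ->
  exists c : T -> nat, forall s t, s < t -> c s <> c t.
Proof.
move=> GT Gunif.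
pose cross t := [set s | s < t /\ exists2 t', t < t' & G t' s].
pose P (b : bool) t s := if b then [/\ limit t, G t s, s < t & ~ cross t s]
                         else successor_of s t.
have [||c cP] := @regressive_coloring setT P; last by exists c => s t; apply: cP.
- move=> t _ nmin; have [lt_t|/contrapT[s st]] := pselect (limit t); last first.
    by exists false, s; split=> //; case: st.
  have [S [Sfin _ SP]] := Gunif t lt_t.
  have [s [Gts st nSs]] := limit_neighbour_avoid GT lt_t nmin Sfin.
  exists true, s; split=> //; split=> // -[_ [t' tt' Gt's]].
  by apply: nSs; apply: SP Gt's st.
(* If [t < t'] had the same image [s], then either the edge from [t'] to [s] would jump over [t], or
   [t] would lie strictly between [s] and its successor [t']. *)
- move=> [] s t t' _ _ tt' /=; last by move=> [st _] [_ []]; exists t; rewrite st.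
  by move=> [_ _ st ncross] [_ Gt's _ _]; apply: ncross; split=> //; exists t'.
Qed.

(** * Levels up to an ordinal *)

Section Levels.
Context {d' : Order.disp_t} {Q : porderType d'} (B : set Q).
Implicit Types f g : T -> Q.

(** The conditions of [order_type_le] with the map exposed, so that two witnesses can be
    compared. *)
Let initial_embedding f A :=
  [/\ f @` A `<=` B,
      (forall x y, A x -> A y -> x < y -> f x < f y) &
      (forall x b, A x -> B b -> b < f x -> (f @` A) b)].

Lemma initial_embedding_reflects f t x y :
    initial_embedding f (strict_down_closure t) -> x < t -> y < t -> f y < f x ->
  y < x.
Proof.
move=> [_ fhomo _] xt yt fyx.
have /comparable_ltgtP[//|xy|yx] := comparable_below (ltW yt) (ltW xt).
  have := fhomo x y; rewrite !strict_down_closureP => /(_ xt yt xy) fxy.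
  by have := lt_trans fxy fyx; rewrite ltxx.
by move: fyx; rewrite yx ltxx.
Qed.

Lemma levels_upto_le s t : s <= t -> levels_upto B t -> levels_upto B s.
Proof.
move=> st [f fP]; have [fB fhomo finit] := fP.
have sub x : strict_down_closure s x -> strict_down_closure t x.
  by move=> /strict_down_closureP xs; apply/strict_down_closureP/(lt_le_trans xs).
exists f; split=> [_ [x xs <-]|x y xs ys xy|x b xs Bb bfx].
- by apply: fB; exists x => //; apply: sub.
- by apply: fhomo => //; apply: sub.
have [y yt fyb] := finit x b (sub x xs) Bb bfx.
exists y => //; apply/strict_down_closureP.
move/strict_down_closureP: (xs); apply: lt_trans.
apply: (initial_embedding_reflects fP); last by rewrite fyb.
  exact/strict_down_closureP/sub.
exact/strict_down_closureP.
Qed.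

(** If the maps agree below [x] and [f x < g x], then initiality gives [f x = g y = f y] for some
    [y < x], against monotonicity. *)
Lemma initial_embedding_unique f g s t x : well_ordered B ->
    initial_embedding f (strict_down_closure s) ->
    initial_embedding g (strict_down_closure t) ->
  x < s -> x < t -> f x = g x.
Proof.
move=> Bwo fP gP; elim/tree_ind: x => x IH xs xt.
have noless f1 g1 s1 t1 : initial_embedding f1 (strict_down_closure s1) ->
    initial_embedding g1 (strict_down_closure t1) -> x < s1 -> x < t1 ->
    (forall y, y < x -> f1 y = g1 y) -> ~ (f1 x < g1 x).
  move=> f1P g1P xs1 xt1 fg fgx.
  have [f1B f1homo _] := f1P; have [_ _ g1init] := g1P.
  have [||y /strict_down_closureP yt1 gyfx] := g1init x (f1 x) _ _ fgx.
  - exact/strict_down_closureP.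
  - by apply: f1B; exists x => //; apply/strict_down_closureP.
  have yx : y < x by apply: (initial_embedding_reflects g1P) => //; rewrite gyfx.
  have : f1 y < f1 x.
    by apply: f1homo => //; apply/strict_down_closureP => //; apply: lt_trans xs1.
  by rewrite fg // gyfx ltxx.
have fg y : y < x -> f y = g y.
  by move=> yx; apply: IH => //; apply: lt_trans yx _.
have Bfx : B (f x).
  by case: fP => + _ _; apply; exists x => //; apply/strict_down_closureP.
have Bgx : B (g x).
  by case: gP => + _ _; apply; exists x => //; apply/strict_down_closureP.
have : f x >=< g x by apply: (wo_chainW Bwo); rewrite inE.
case/comparable_ltgtP => // h; exfalso.
  by apply: (noless f g s t) h.
by apply: (noless g f t s) h => // y /fg.
Qed.

(* The embeddings witnessing that the points below [t] lie in the lower levels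
   are unique, hence cohere to one for [t]. *)
Lemma levels_upto_limit t : well_ordered B -> B !=set0 -> limit t ->
  (forall s, s < t -> levels_upto B s) -> levels_upto B t.
Proof.
move=> Bwo [b0 Bb0] lt_t levs.
have /choice[F FP] x : exists b, x < t -> exists s f,
    [/\ x < s, s < t, initial_embedding f (strict_down_closure s) & b = f x].
  have [xt|nxt] := pselect (x < t); last by exists b0.
  have [s [xs _] st] := limit_successor lt_t xt.
  by have [f fP] := levs s st; exists (f x) => _; exists s, f.
exists F; split=> [_ [x /strict_down_closureP xt <-]|x y|x b].
- have [s [f [xs st [fB _ _] ->]]] := FP x xt.
  by apply: fB; exists x => //; apply/strict_down_closureP.
- move=> /strict_down_closureP xt /strict_down_closureP yt xy.
  have [s [f [xs st fP ->]]] := FP x xt.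
  have [s' [f' [ys' s't f'P ->]]] := FP y yt.
  rewrite (initial_embedding_unique Bwo fP f'P xs (lt_trans xy ys')).
  have [_ f'homo _] := f'P; apply: f'homo => //; apply/strict_down_closureP => //.
  exact: lt_trans ys'.
- move=> /strict_down_closureP xt Bb; have [s [f [xs st fP ->]]] := FP x xt => bfx.
  have [_ _ finit] := fP.
  have [|y /strict_down_closureP ys <-] := finit x b _ Bb bfx.
    exact/strict_down_closureP.
  have yt := lt_trans ys st; exists y; first exact/strict_down_closureP.
  have [s' [f' [ys' s't f'P ->]]] := FP y yt.
  exact: initial_embedding_unique Bwo f'P fP ys' ys.
Qed.

End Levels.

Lemma levels_upto_self u t : t <= u -> levels_upto (strict_down_closure u) t.
Proof.
move=> tu; apply: (levels_upto_le tu); exists id; split=> // [_ [x xu <-] //|x b _ bu _].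
by exists b.
Qed.

(* A strictly increasing map into a proper initial segment would move some
   point down, and the least such point gives a contradiction. *)
Lemma levels_upto_above u t : u < t -> ~ levels_upto (strict_down_closure u) t.
Proof.
move=> ut [f [fu fhomo _]].
have fut x : x < t -> f x < u.
  by move=> /strict_down_closureP xt; apply/strict_down_closureP/fu; exists x.
have [|m [[mt fmm] _ mmin]] := @least_below [set x | x < t /\ f x < x] u.
  by split=> //; apply: fut.
have fmt := lt_trans fmm mt.
have mu : m <= u by apply: mmin => //; split=> //; apply: fut.
have ffm : f (f m) < f m by apply: fhomo => //; apply/strict_down_closureP.
by have := mmin (f m) (conj fmt ffm) (ltW (fut _ mt)); rewrite (lt_geF fmm).
Qed.

Lemma strict_down_closure_limit u : limit u -> ~ minimal u ->
  limit_ordinal (strict_down_closure u).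
Proof.
move=> lt_u /nonminimal[s su]; split.
- move=> A subA; apply: (hT.2 u) => x /subA; rewrite !inE; exact: proj1.
- by exists s; apply/strict_down_closureP.
- move=> b /strict_down_closureP /(limit_successor lt_u)[c [bc _] cu].
  by exists c => //; apply/strict_down_closureP.
Qed.

(** * Finite adhesion and colorings of successors *)

Lemma up_closure_connected (G : graph T) A v t : T_graph G ->
  (forall w, v <= w -> A w) -> v <= t -> connected_in G A v t.
Proof.
move=> [_ Gcof] upA; elim/tree_ind: t => t IH.
rewrite le_eqVlt => /predU1P[<-|vt].
  by exists [::]; split=> // -[|//] _; apply: upA.
have [s [Gts st] vs] := (Gcof t).2 v ((strict_down_closureP v t).2 vt).
apply: connected_in_step (IH s st vs) _ _; first exact/upA/ltW.
by rewrite adj_sym.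
Qed.

(** Finite adhesion is used at the height of [u]. All points at or above [v] lie in one component
    there; the lower ends of the crossing edges are at most [u], hence in its neighbourhood. *)
Lemma finite_adhesion_crossing (G : graph T) u v : T_graph G ->
    finite_adhesion G -> limit u -> ~ minimal u -> successor_of u v ->
  finite_set [set s | s < v /\ exists2 t, v <= t & G t s].
Proof.
move=> GT Gfin lt_u nmin uv.
pose A : set T := (~` levels_upto (strict_down_closure u))%classic.
have upA w : v <= w -> A w.
  by move=> vw; apply: levels_upto_above; apply: lt_le_trans vw; case: uv.
apply: sub_finite_set (Gfin _ _ _ (strict_down_closure_limit lt_u nmin)
  [set y | connected_in G A v y] _); last by exists v => //; apply: upA.
move=> s [sv [t vt Gts]]; split.
  move=> Cs; apply: (connected_in_mem Cs).
  by apply: levels_upto_self; apply: successor_of_le sv.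
by exists t => //; apply: up_closure_connected.
Qed.

(** The root is added as the endpoint of the regressive descents. *)
Definition root_or_successor : set T :=
  [set t | minimal t \/ exists s, successor_of s t].

Lemma coloring_of_finite_adhesion (G : graph T) : T_graph G -> finite_adhesion G ->
  exists c : T -> nat, forall s t, root_or_successor s -> root_or_successor t ->
    s < t -> c s <> c t.
Proof.
move=> GT Gfin; pose cross t := [set s | s < t /\ exists2 t', t <= t' & G t' s].
(* Color [true] serves when the predecessor [u] is a limit other than the root. The image is the
   successor of the neighbor [w], since [w] itself may be a limit. *)
pose P (b : bool) s t :=
  if b then exists u w,
    [/\ successor_of u s, G u w, successor_of w t, t < u & ~ cross s w]
  else successor_of t s.
apply: (@regressive_coloring root_or_successor P) =>
    [t [//|[u ut]] _|[] s t t' _ _ tt'] /=.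
- have [Xu|nXu] := pselect (root_or_successor u).
    by exists false, u; split=> //; case: ut.
  have nmin : ~ minimal u by move=> ?; apply: nXu; left.
  have lt_u : limit u by move=> ?; apply: nXu; right.
  have [w [Guw wu ncross]] := limit_neighbour_avoid GT lt_u nmin
    (finite_adhesion_crossing GT Gfin lt_u nmin ut).
  have [s ws su] := limit_successor lt_u wu.
  exists true, s; split; first by right; exists w.
    by apply: lt_trans su _; case: ut.
  by exists u, w.
(* A common image gives [w = w'], and the edge from [u'] to [w] then crosses [t] because
   [t <= u']. *)
- move=> [u [w [ut _ ws su ncross]]] [u' [w' [u't' Gu'w' w's _ _]]].
  apply: ncross; rewrite (successor_of_inj ws w's); split.
    by case: w's => w's _; apply: lt_trans w's (lt_trans su _); case: ut.
  by exists u' => //; apply: successor_of_le tt'.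
- by move=> [st _] [_ []]; exists t; rewrite st.
Qed.

(** A component lies above a least point [t] outside the levels, and [t] is a successor because a
    limit enters the levels with all points below it. An edge leaving the component downwards ends
    in the predecessor of [t], or jumps over [t] to one of finitely many points of smaller color. *)
Lemma finite_adhesion_of_coloring (c : T -> nat)
    (X := [set t | exists s, successor_of s t]) :
    (forall s t, X s -> X t -> s < t -> c s <> c t) ->
  exists G : graph T, T_graph G /\ finite_adhesion G.
Proof.
move=> c_inj; have GT : T_graph (record_graph X c).
  by apply: record_graph_T => // s t st; exists s.
exists (record_graph X c); split=> // d' Q B [Bwo B0 _] _ [x Ax ->].
set A : set T := (~` levels_upto B)%classic in Ax *.
set G := record_graph X c in GT *.
have upA s t : s <= t -> A s -> A t by move=> st As /(levels_upto_le st).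
have [t [At tx tmin]] := least_below Ax.
have [p pt] : X t.
  apply: contrapT => nXt; apply: At; apply: levels_upto_limit => // s st.
  apply: contrapT => As; have := tmin s As (ltW (lt_le_trans st tx)).
  by rewrite (lt_geF st).
have above w : connected_in G A x w -> t <= w.
  apply: (@connected_in_invariant _ G A (fun w => t <= w)) => // u v tu Av Guv.
  have /comparable_leP[uv|/ltW vu] := GT.1 u v Guv; first exact: le_trans uv.
  have /comparable_leP[//|vt] := comparable_below tu vu.
  by have := tmin v Av (ltW (lt_le_trans vt tx)); rewrite (lt_geF vt).
apply: (@sub_finite_set _ _
  ([set p] `|` [set s | [/\ X s, s < t & (c s < c t)%N]])); last first.
  by rewrite finite_setU; split=> //; apply: finite_color_below.
move=> v [nCv [w Cw Gwv]].
have nAv : ~ A v by move=> Av; apply: nCv; apply: connected_in_step Cw Av Gwv.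
have Xt : X t by exists p.
have vt : v < t.
  have vw : v < w.
    have /comparable_leP[wv|//] := GT.1 w v Gwv.
    by case: nAv; apply: upA wv (connected_in_mem Cw).
  have /comparable_leP[tv|//] := comparable_below (above w Cw) (ltW vw).
  by case: nAv; apply: upA tv At.
have := above w Cw; rewrite le_eqVlt => /predU1P[tw|tw].
  left; move: Gwv; rewrite -tw => /record_graph_below/(_ vt)[_ [vt'|[[]//]]].
  exact: successor_of_inj vt' pt.
by right; have [] := record_graph_across Xt vt tw Gwv.
Qed.

Lemma embeds_real_coloring (R : realType) : embeds T R ->
  exists c : T -> nat, forall s t, (exists p, successor_of p s) ->
    (exists p, successor_of p t) -> s < t -> c s <> c t.
Proof.
move=> [f fhomo].
have /choice[g gP] t : exists q : rat, forall p, successor_of p t ->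
    (f p < ratr q)%R /\ (ratr q < f t)%R.
  have [[p pt]|npt] := pselect (exists p, successor_of p t); last first.
    by exists 0%R => p pt; case: npt; exists p.
  have [q] := rat_in_itvoo (fhomo p t (proj1 pt)).
  rewrite in_itv /= => /andP[pq qt]; exists q => p' p't.
  by rewrite (successor_of_inj p't pt).
exists (pickle \o g) => s t [p ps] [q qt] st /(pcan_inj pickleK) gst.
have [_ gs] := gP s p ps; have [gt _] := gP t q qt.
(* Since [s <= q], the intervals from [f p] to [f s] and from [f q] to [f t] are disjoint, so the
   chosen rationals differ. *)
have : (f s <= f q)%R by apply: (ltW_homo fhomo); apply: successor_of_le st.
by rewrite leNgt (lt_trans gt) // -gst.
Qed.

End OrderTreeTheory.

Theorem theorem4p5 (R : realType) (d : Order.disp_t) (T : porderType d)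
    (hT : order_tree T) :
  ((exists G : graph T, T_graph G /\ uniform G) <-> embeds T rat) /\
  ((exists G : graph T, T_graph G /\ finite_adhesion G) <-> embeds T R).
Proof.
split; split.
- move=> [G [GT /(coloring_of_uniform hT GT)[c]]]; exact: embeds_rat.
- move=> [f fhomo]; apply: (uniform_of_coloring hT (c := pickle \o f)).
  by move=> s t /fhomo + /(pcan_inj pickleK) fst; rewrite fst ltxx.
- move=> [G [GT /(coloring_of_finite_adhesion hT GT)[c cP]]].
  apply: (embeds_real R cP) => s t /(exists_successor hT)[u su ut].
  by exists u; split=> //; [right; exists s|case: su].
- by move=> /(embeds_real_coloring hT)[c]; apply: finite_adhesion_of_coloring.
Qed.
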